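(* Let $\mathfrak{m}$ (respectively $\mathfrak{n}$) be the least cardinal such that every infinite precompact abelian group admits an infinite quotient group of density at most $\mathfrak{m}$ (respectively of weight at most $\mathfrak{n}$). If the generalized continuum hypothesis holds, then $\mathfrak{m}=\mathfrak{c}$ and $\mathfrak{n}=2^{\mathfrak{c}}$.
   Context: All topological groups are Hausdorff. A topological group $G$ is precompact if for every neighborhood $U$ of the identity there is a finite $F\subseteq G$ with $G=FU$. A quotient group of an abelian topological group $G$ is $G/N$ with the quotient topology, where $N$ is a closed subgroup. The density of a space is the least cardinality of a dense subset; the weight is the least cardinality of a base. $\mathfrak{c}=2^\omega$. *)

(* Defs.v *)
From HB Require Import structures.
From mathcomp Require Import all_boot all_order all_algebra.
From mathcomp Require Import all_classical topology normedtype.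

Set Implicit Arguments.
Unset Strict Implicit.
Unset Printing Implicit Defensive.

Import GRing.Theory.

Local Open Scope classical_set_scope.
Local Open Scope card_scope.
Local Open Scope ring_scope.
Local Open Scope quotient_scope.

(* A cardinal is represented by a type K, i.e. by the cardinality of
   [set: K]; then [set: set K] has cardinality 2 ^ K. *)

Definition is_least_cardinal (P : Type -> Prop) (K : Type) : Prop :=
  P K /\ forall L : Type, P L -> [set: K] #<= [set: L].

Definition GCH : Prop :=
  forall K L : Type, infinite_set [set: K] ->
    [set: K] #<= [set: L] -> [set: L] #<= [set: set K] ->
    [set: L] #= [set: K] \/ [set: L] #= [set: set K].

Definition continuum : Type := set nat.

Definition is_density (T : topologicalType) : Type -> Prop :=
  is_least_cardinal (fun K => exists2 D : set T, dense D & D #= [set: K]).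

Definition is_weight (T : topologicalType) : Type -> Prop :=
  is_least_cardinal (fun K => exists2 B : set (set T), basis B & B #= [set: K]).

Definition density_at_most (K : Type) (T : topologicalType) : Prop :=
  exists2 d : Type, is_density T d & [set: d] #<= [set: K].

Definition weight_at_most (K : Type) (T : topologicalType) : Prop :=
  exists2 w : Type, is_weight T w & [set: w] #<= [set: K].

Definition precompact_group (G : topologicalZmodType) : Prop :=
  forall U : set G, nbhs 0 U ->
    exists2 F : set G, finite_set F & [set x + u | x in F & u in U] = [set: G].

Definition quotient_group (G : topologicalZmodType) (N : zmodClosed G) : Type :=
  quotient_topology (Quotient.quot N).

Section quotient_group.
Context (G : topologicalZmodType) (N : zmodClosed G).
Local Notation Q := (quotient_group N).

HB.instance Definition _ := Topological.on Q.
(* GRing.Zmodule.copy would bring in a choiceType structure different from the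
   one quotient_topology carries. *)
HB.instance Definition _ := GRing.isZmodule.Build Q
  (@Quotient.addqA G N) (@Quotient.addqC G N)
  (@Quotient.add0q G N) (@Quotient.addNq G N).

Let pi : G -> Q := \pi_(Quotient.quot N).

Let piB : {morph pi : x y / x - y}.
Proof.
by move=> x y; rewrite /pi (@Quotient.pi_add _ N) (@Quotient.pi_opp _ N).
Qed.

Let pi_surj (q : Q) : exists x, pi x = q.
Proof. by exists (repr (q : Quotient.quot N)); exact: reprK. Qed.

Let eq_pi (x y : G) : (pi x = pi y) <-> (x - y \in N).
Proof. by rewrite Quotient.idealrBE; split => [h|/eqP //]; apply/eqP. Qed.

Let pi_continuous : continuous pi.
Proof. exact: (@pi_continuous G (Quotient.quot N)). Qed.

Let pi_open (U : set G) : open U -> open (pi @` U).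
Proof.
move=> oU; suff : open (pi @^-1` (pi @` U)) by [].
have -> : pi @^-1` (pi @` U) = \bigcup_(n in [set` N]) (+%R^~ n @^-1` U).
  apply/seteqP; split => [x [u Uu uxE]|x [n Nn] Uxn].
    exists (u - x); first by apply/eq_pi.
    by rewrite /= addrC subrK.
  exists (x + n) => //; apply/eq_pi.
  by rewrite addrC addKr.
apply: bigcup_open => n _; apply: open_comp => // x _.
apply: (@continuous_comp _ _ _ (fun x => (x, n)) (fun z : G * G => z.1 + z.2)).
  by apply: cvg_pair => /=; [exact: cvg_id|exact: cvg_cst].
exact: add_continuous.
Qed.

Let nbhs_pi (x : G) (A : set G) : nbhs x A -> nbhs (pi x) (pi @` A).
Proof.
rewrite nbhsE => -[U [oU Ux] UA]; rewrite nbhsE.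
by exists (pi @` U); [split; [exact: pi_open|exists x]|exact: image_subset].
Qed.

Let quotient_sub_continuous : continuous (fun z : Q * Q => z.1 - z.2).
Proof.
move=> [p q] W /=; have [x <-] := pi_surj p; have [y <-] := pi_surj q.
rewrite -piB => /pi_continuous /(@sub_continuous G (x, y))[[A B] /= [Ax By] AB].
exists (pi @` A, pi @` B); first by split; exact: nbhs_pi.
move=> [_ _] /= [[a Aa <-] [b Bb <-]]; rewrite -piB.
exact: (AB (a, b)).
Qed.

HB.instance Definition _ :=
  PreTopologicalNmodule_isTopologicalZmodule.Build Q quotient_sub_continuous.

End quotient_group.

Definition quotient_density_bound (K : Type) : Prop :=
  forall G : topologicalZmodType,
    hausdorff_space G -> precompact_group G -> infinite_set [set: G] ->
    exists N : zmodClosed G,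
      [/\ closed [set` N], infinite_set [set: quotient_group N]
        & density_at_most K (quotient_group N)].

Definition quotient_weight_bound (K : Type) : Prop :=
  forall G : topologicalZmodType,
    hausdorff_space G -> precompact_group G -> infinite_set [set: G] ->
    exists N : zmodClosed G,
      [/\ closed [set` N], infinite_set [set: quotient_group N]
        & weight_at_most K (quotient_group N)].

(* Main.v *)
Require Import Defs.
From HB Require Import structures.
From mathcomp Require Import all_boot all_algebra.
From mathcomp Require Import all_classical topology normedtype wochoice.

Set Implicit Arguments.
Unset Strict Implicit.
Unset Printing Implicit Defensive.

Import GRing.Theory.
Local Open Scope classical_set_scope.
Local Open Scope card_scope.
Local Open Scope ring_scope.

(** Write c for the cardinality of [set nat].

    Upper bounds, valid in ZFC.  Let G be infinite, Hausdorff and precompact.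
    Choose neighbourhoods U_k of 0 with U_(k+1) - U_(k+1) contained in U_k,
    such that U_(k+1) omits the k-th difference of an injective sequence.  Their
    intersection N is a closed subgroup; the members of the sequence stay
    distinct modulo N, and since G is covered by finitely many translates of
    each U_k, a coset of N is determined by a sequence of natural numbers.  So
    G/N is infinite of cardinality at most c, hence of density at most c and of
    weight at most 2^c ([small_quotient]).

    Lower bounds.  Under GCH it suffices to find one infinite precompact group
    V none of whose infinite quotients is separable or has weight at most c
    ([no_small_quotient]).  Its points are functions v from an index set X to
    F_2 (written bool), with the topology of pointwise convergence; a finite
    subset t of X gives the continuous character v |-> sum of v over t, and a
    closed subgroup N is the intersection of the kernels of the characters
    vanishing on it ([dual_closed]).  If V/N is infinite, the characters
    vanishing on N involve infinitely many coordinates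
    ([infinite_annihilator]), so some sequence b_0, b_1, ... of finite subsets
    of X has infinite union and its characters vanish on N.  The group is built
    so that for every such sequence b there are 2^c coordinates x in X on which
    each v in V satisfies

        v x = phi_x (n |-> sum of v over b_n),                             ( * )

    where phi_x is an additive map from sequences of bits to bits.  All these
    coordinates vanish on N, so V/N has 2^c distinct continuous characters, each
    given by evaluation at a coordinate.  A countable dense set of V/N would
    distinguish at most c of them; and a base of size at most c would do the
    same, because a neighbourhood of 0 restricts only finitely many coordinates.

    Since x must know b and there must be 2^c many x for a given b, X is taken
    to be a type of well-founded countably branching trees labelled by sets of
    sets of natural numbers.  V is the group of all solutions of ( * ), and what
    has to be ensured by the choice of phi is that the coordinates of V are
    independent: for x outside a finite set s some v in V is 1 at x and 0 on s
    ([free_coordinates]).  A solution of the equations on a subset E of X closed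
    under children extends to a solution on X, so it is enough to find suitable
    values on a countable E.  There are only c isomorphism types of such E
    together with a device recognizing the members of E inside X
    ([recognize_sequence]).  By CH these c codes are
    well-ordered with countable initial segments ([omega1_order]).  By
    recursion on the code, one chooses the values v on E so that none of the
    countably many sequences n |-> sum of v over b_n lies in the span of the
    countably many sequences met before; this is a finite-extension argument
    ([generic_vector]).  The equations required of each single phi_x then have
    linearly independent arguments, so phi_x exists
    ([prescribed_functionals]). *)

(** * Cardinal arithmetic *)

(** Comparison of the cardinalities of types: [T] injects into [U]. *)
Definition embeds (T U : Type) : Prop := exists f : T -> U, injective f.

Lemma embeds_refl (T : Type) : embeds T T.
Proof. by exists id. Qed.

Lemma embeds_trans (T U V : Type) : embeds T U -> embeds U V -> embeds T V.
Proof. by move=> [f fI] [g gI]; exists (g \o f); exact: inj_comp. Qed.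

Lemma card_le_embeds (T U : Type) (A : set T) (B : set U) :
  A #<= B <-> embeds A B.
Proof.
split=> [/card_leP[f]|[f fI]].
  by exists f => x y; apply: (@inj _ _ _ f); rewrite in_setT.
by apply/card_leP; rewrite injfunPex; exists f => // x y _ _; exact: fI.
Qed.

Lemma embedsP (T U : Type) : embeds T U <-> [set: T] #<= [set: U].
Proof.
rewrite card_le_embeds; split=> -[f fI].
  exists (fun x => to_setT (f (\val x))) => x y.
  by move=> /(congr1 \val) /= /fI /val_inj.
exists (fun x => \val (f (to_setT x))) => x y /= /val_inj /fI.
by move=> /(congr1 \val).
Qed.

Lemma countable_embeds (T : Type) (A : set T) : countable A <-> embeds A nat.
Proof.
rewrite /countable card_le_embeds; split=> h; apply: embeds_trans h _.
  by exists \val; exact: val_inj.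
by exists to_setT => x y /(congr1 \val).
Qed.

(** Cardinals are well-ordered.  A maximal set of choice functions on which all
    projections are injective has a surjective projection onto some [A i], since
    otherwise a choice function avoiding all the projections could be added. *)
Lemma least_type (I : Type) (A : I -> Type) :
  inhabited I -> exists i, forall j, embeds (A i) (A j).
Proof.
move=> [i0].
pose P (S : set (forall i, A i)) :=
  forall s t, S s -> S t -> forall i, s i = t i -> s = t.
have [F FP Ftot|S [PS Smax]] := @Zorn_bigcup (forall i, A i) P.
  move=> s t [X FX Xs] [Y FY Yt]; have [XY|YX] := Ftot _ _ FX FY.
    by apply: (FP _ FY) => //; exact: XY.
  by apply: (FP _ FX) => //; exact: YX.
suff [i surj_i] : exists i, forall a : A i, exists2 s, S s & s i = a.
  exists i => j.
  have /choice [g gP] : forall a : A i, exists s, S s /\ s i = a.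
    by move=> a; have [s] := surj_i a; exists s.
  exists (fun a => g a j) => a b gab.
  have [Sa <-] := gP a; have [Sb <-] := gP b.
  by rewrite (PS _ _ Sa Sb _ gab).
apply: contrapT => nosurj.
have /(_ _)/cid xP i : exists a : A i, forall s, S s -> s i <> a.
  apply: contrapT => h; apply: nosurj; exists i => a.
  apply: contrapT => ha; apply: h; exists a => s Ss sa.
  by apply: ha; exists s.
pose x i := sval (xP i).
have xN i s : S s -> s i <> x i by rewrite /x; case: (xP i) => a h /=; exact: h.
apply: (Smax (S `|` [set x])).
  split; first by exact: subsetUl.
  move=> h; have Sx : S x by apply: h; right.
  exact: (xN i0 x Sx).
move=> s t [Ss|->] [St|->] i //; first exact: PS.
- by move=> h; case: (xN i s Ss).
- by move=> h; case: (xN i t St).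
Qed.

Lemma embeds_total (T U : Type) : embeds T U \/ embeds U T.
Proof.
have [[] h] := @least_type bool (fun b => if b then T else U) (inhabits true).
  by left; exact: (h false).
by right; exact: (h true).
Qed.

Lemma not_embeds_set (T : Type) : ~ embeds (set T) T.
Proof.
move=> [f fI]; pose D := [set x | exists2 A, f A = x & ~ A x].
have [Df|nDf] := pselect (D (f D)); last by apply: (nDf); exists D.
by have [A /fI AD nA] := Df; apply: nA; rewrite AD.
Qed.

(** Any nonempty family of subsets has a least cardinality; applied to dense
    sets and to bases, this gives the existence of density and weight. *)
Lemma least_cardinal_of_set (T : Type) (Q : set (set T)) :
  Q !=set0 ->
  exists K, is_least_cardinal (fun K => exists2 D, Q D & D #= [set: K]) K.
Proof.
move=> [D0 QD0].
have [D h] := @least_type {D : set T | Q D} (fun D => sval D)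
  (inhabits (exist _ D0 QD0)).
exists (set_type (sval D)); split.
  by exists (sval D); [exact: svalP|exact: card_setT_sym].
move=> L [E QE EL]; rewrite -(card_le_eqr EL) -(card_le_eql (card_setT_sym _)).
by apply/card_le_embeds; exact: (h (exist _ E QE)).
Qed.

Lemma GCH_between (K L : Type) : GCH -> embeds nat K ->
  embeds K L -> embeds L (set K) -> embeds L K \/ embeds (set K) L.
Proof.
move=> gch /embedsP /infiniteP Kinf /embedsP KL /embedsP LK.
have [/card_eqPle[h _]|/card_eqPle[_ h]] := gch K L Kinf KL LK.
  by left; apply/embedsP.
by right; apply/embedsP.
Qed.

(** Under CH a type of cardinality at most c has a well-ordering with countable
    initial segments: if some initial segment of a given well-ordering is
    uncountable, the least such one has cardinality c, and the order is
    transported along an injection into it. *)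
Lemma omega1_order (C : Type) : GCH -> embeds C (set nat) ->
  exists lt : C -> C -> Prop, [/\ well_founded lt,
    forall c d, [\/ lt c d, c = d | lt d c] &
    forall c, countable [set d | lt d c]].
Proof.
move=> gch Csmall.
have [R Rwo] := @well_ordering_principle {classic C}.
pose lt (c d : C) := R c d /\ c <> d.
have minP (P : set C) : P !=set0 -> exists2 z, P z & forall x, P x -> R z x.
  move=> [x Px]; have [|z [[zP zmin] _]] := Rwo (fun x => `[< P x >]).
    by exists x; apply/asboolP.
  exists z; first exact/asboolP.
  by move=> y Py; apply: zmin; apply/asboolP.
have Ranti c d : R c d -> R d c -> c = d.
  have wo : wo_chain R predT by apply: withinW => A; exact: Rwo.
  by move=> Rcd Rdc; apply: (wo_chain_antisymmetric wo) => //; rewrite Rcd.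
have Rtot c d : R c d \/ R d c.
  have cd0 : [set x | x = c \/ x = d] !=set0 by exists c; left.
  have [z [->|->] h] := minP _ cd0.
    by left; apply: h; right.
  by right; apply: h; left.
have lt_wf : well_founded lt.
  move=> c; apply: contrapT => nc.
  have [z nz zmin] := minP [set x | ~ Acc lt x] (ex_intro _ c nc).
  apply: nz; constructor => y [Ryz yz]; apply: contrapT => ny.
  by apply: yz; apply: Ranti => //; exact: zmin.
have lt_tri c d : [\/ lt c d, c = d | lt d c].
  have [->|cd] := pselect (c = d); first by constructor 2.
  have [h|h] := Rtot c d; first by constructor 1.
  by constructor 3; split=> // /esym.
have [allc|/existsNP[c1 c1P]] := pselect (forall c, countable [set d | lt d c]).
  by exists lt.
have [c0 c0P c0min] :=
  minP [set c | ~ countable [set d | lt d c]] (ex_intro _ c1 c1P).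
pose I := set_type [set d | lt d c0].
have Isub : embeds I C by exists \val; exact: val_inj.
have natI : embeds nat I.
  by have [//|] := embeds_total nat I; move=> /countable_embeds.
have [/countable_embeds//|CI] :=
  GCH_between gch (embeds_refl nat) natI (embeds_trans Isub Csmall).
have [g gI] := embeds_trans Csmall CI.
exists (fun c d => lt (\val (g c)) (\val (g d))); split.
- move=> c; have [x] : exists x, \val (g c) = x by exists (\val (g c)).
  elim/(well_founded_ind lt_wf): x c => x IH c xE; constructor => d ltd.
  by apply: IH (erefl _); rewrite -xE.
- move=> c d; have [h|/val_inj/gI h|h] := lt_tri (\val (g c)) (\val (g d)).
  + by constructor 1.
  + by constructor 2.
  + by constructor 3.
- move=> c; apply/countable_embeds.
  have : countable [set d | lt d (\val (g c))].
    apply: contrapT => h; have Rc := c0min _ h.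
    have /set_mem[Rc' nc] := valP (g c); exact: nc (Ranti _ _ _ _).
  move=> /countable_embeds; apply: embeds_trans.
  exists (fun d : [set d | lt (\val (g d)) (\val (g c))] =>
     @SigSub _ _ [set d | lt d (\val (g c))] (\val (g (\val d)))
       (mem_set (set_mem (valP d)))) => x y /(congr1 \val) /= /val_inj /gI.
  exact: val_inj.
Qed.

(** * Linear algebra over the field with two elements *)

(** In a group of exponent 2, an element [w] outside a subgroup [S] is separated
    from it by a homomorphism to bool: a maximal subgroup [T] containing [S] but
    not [w] has index 2. *)
Lemma separating_character (M : zmodType) (S : set M) (w : M) :
  (forall x : M, x + x = 0) ->
  S 0 -> (forall x y, S x -> S y -> S (x + y)) -> ~ S w ->
  exists phi : M -> bool, [/\ {morph phi : x y / x + y},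
    forall x, S x -> phi x = false & phi w = true].
Proof.
move=> M2 S0 SD Sw.
pose cl (A : set M) := forall x y, A x -> A y -> A (x + y).
pose P (A : set M) := cl (A `|` S) /\ ~ A w.
have [F FP Ftot|A [[clA Aw] Amax]] := @Zorn_bigcup M P.
  split; last by move=> [X /FP[_ Xw]].
  have main X x y : F X -> (X `|` S) x -> (X `|` S) y ->
      (\bigcup_(Y in F) Y `|` S) (x + y).
    move=> FX Xx Xy; have [clX _] := FP _ FX.
    by have [h|h] := clX _ _ Xx Xy; [left; exists X|right].
  move=> x y [[X FX Xx]|Sx] [[Y FY Yy]|Sy].
  - have [XY|YX] := Ftot _ _ FX FY.
      by apply: (main Y) => //; left=> //; exact: XY.
    by apply: (main X) => //; left=> //; exact: YX.
  - by apply: (main X) => //; [left|right].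
  - by apply: (main Y) => //; [right|left].
  - by right; exact: SD.
pose T := A `|` S.
have T0 : T 0 by right.
have Tw : ~ T w by case.
have NT x : ~ T x -> T (x + w).
  move=> nTx; pose B := T `|` [set x + t | t in T].
  have AB : A `<` B.
    split; first by move=> a Aa; left; left.
    by move=> BA; apply: nTx; left; apply: BA; right; exists 0; rewrite ?addr0.
  have BS : B `|` S = B by apply/setUidPl => s Ss; left; right.
  have clB : cl (B `|` S).
    rewrite BS => x' y' [Ta|[a Ta <-{x'}]] [Tb|[b Tb <-{y'}]].
    - by left; exact: clA.
    - by right; exists (x' + b); [exact: clA|rewrite addrCA].
    - by right; exists (a + y'); [exact: clA|rewrite addrA].
    - by left; rewrite addrACA M2 add0r; exact: clA.
  have : B w by apply: contrapT => nB; apply: (Amax B AB).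
  by move=> [/Tw//|[t Tt <-]]; rewrite addrA M2 add0r.
exists (fun x => ~~ `[< T x >]); split; last by apply/negP => /asboolP.
- have negT (a b : M) : T a -> `[< T (a + b) >] = `[< T b >].
    move=> Ta; apply/asboolP/asboolP => [h|]; last exact: clA.
    by rewrite -[b]add0r -(M2 a) -addrA; exact: clA.
  move=> x y; have [Tx|nTx] := pselect (T x).
    by rewrite negT// (asboolT Tx).
  have [Ty|nTy] := pselect (T y).
    by rewrite addrC negT// (asboolT Ty) (asboolF nTx).
  rewrite (asboolF nTx) (asboolF nTy) asboolT//.
  have -> : x + y = (x + w) + (y + w).
    by rewrite addrACA M2 addr0.
  by apply: clA; exact: NT.
- by move=> x Sx; rewrite asboolT//; right.
Qed.

(** The additive submonoid generated by [S]; in a group of exponent 2 this is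
    the subgroup generated by [S]. *)
Inductive span (M : zmodType) (S : set M) : M -> Prop :=
  | span0 : span S 0
  | spanS x y : S x -> span S y -> span S (x + y).

Lemma spanD (M : zmodType) (S : set M) x y :
  span S x -> span S y -> span S (x + y).
Proof.
elim=> [|a b Sa _ IH] Sy; first by rewrite add0r.
by rewrite -addrA; apply: spanS => //; exact: IH.
Qed.

Lemma span_incl (M : zmodType) (S : set M) x : S x -> span S x.
Proof. by move=> Sx; rewrite -[x]addr0; apply: spanS => //; exact: span0. Qed.

Lemma span_enum (M : zmodType) (S : set M) : countable S ->
  exists e : nat -> M, forall x, span S x -> exists n, e n = x.
Proof.
move=> /countable_injP[f fI].
have /choice[g gP] : forall n, exists x, forall y, S y -> f y = n -> y = x.
  move=> n; have [[x [Sx fx]]|h] := pselect (exists x, S x /\ f x = n).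
    by exists x => y Sy fy; apply: fI; rewrite ?inE // fx.
  by exists 0 => y Sy fy; case: h; exists y.
exists (fun n => \sum_(i <- odflt [::] (unpickle n)) g i) => x.
suff h : span S x -> exists s : seq nat, x = \sum_(i <- s) g i.
  by move=> /h[s ->]; exists (pickle s); rewrite pickleK.
elim=> [|a b Sa _ [s ->]]; first by exists [::]; rewrite big_nil.
by exists (f a :: s); rewrite big_cons -(gP _ a Sa).
Qed.

(** A family indexed by a subset [D] of a well-order, each member of which is
    outside the span of the earlier ones, can be sent to arbitrary values by a
    homomorphism.  The graph of the prescription generates a subgroup of
    [M * bool] which does not contain (0, 1), and a homomorphism separating
    (0, 1) from this subgroup gives the extension. *)
Lemma independent_extension (C : Type) (lt : C -> C -> Prop) (D : set C)
    (M : zmodType) (u : C -> M) (y : C -> bool) :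
  (forall x : M, x + x = 0) -> well_founded lt ->
  (forall c d, [\/ lt c d, c = d | lt d c]) ->
  (forall c, D c -> ~ span [set u d | d in [set d | D d /\ lt d c]] (u c)) ->
  exists2 phi : M -> bool, {morph phi : a b / a + b} &
    forall c, D c -> phi (u c) = y c.
Proof.
move=> M2 lt_wf lt_tri indep.
pose G (E : set C) := span [set (u d, y d) | d in [set d | D d /\ E d]].
pose le c d := d = c \/ lt d c.
have lt_trans a b c : lt a b -> lt b c -> lt a c.
  move=> ab bc; have [//|ac|ca] := lt_tri a c.
    have asym p q : lt p q -> ~ lt q p.
      elim/(well_founded_ind lt_wf): p q => p IH q pq qp.
      exact: (IH q qp p).
    by move: bc; rewrite -ac => /asym.
  exfalso; elim/(well_founded_ind lt_wf): a b c ab bc ca => a IH b c ab bc ca.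
  exact: (IH c ca a b ca ab bc).
(* [G E] is the span of the graph over the indices in [E]. *)
have proj1 E x : G E x -> span [set u d | d in [set d | D d /\ E d]] x.1.
  elim=> [|z' b [d dE <-{z'}] _ IH]; first exact: span0.
  by apply: spanS => //; exists d.
(* A nonzero element of [G E] involves a largest index. *)
have stage (E : set C) x : G E x -> x = 0 \/ exists2 c, D c /\ E c & G (le c) x.
  elim=> [|z' b [d [Dd Ed] <-{z'}] Gb [->|[c [Dc Ec] IH]]]; first by left.
    right; exists d => //; rewrite addr0; apply: span_incl.
    by exists d => //; split => //; left.
  right; have mono p q : (p = q \/ lt p q) ->
      forall z, G (le p) z -> G (le q) z.
    move=> pq z; elim=> [|r' z' [r [Dr rp] <-{r'}] _ IHz]; first exact: span0.
    apply: spanS => //; exists r => //; split => //.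
    case: pq rp => [<-//|pq] [->|rp]; right => //; exact: lt_trans pq.
  have [dc|->|cd] := lt_tri d c.
  - exists c => //; apply: spanS => //; exists d => //; split => //; by right.
  - exists c => //; apply: spanS => //; exists c => //; split=> //; by left.
  - exists d => //; apply: spanS; first by exists d => //; split=> //; left.
    by apply: mono IH; right.
pose p c : M * bool := (u c, y c).
have MB2 (x : M * bool) : x + x = 0.
  by case: x => a b; congr pair => /=; [exact: M2|exact: addbb].
have no1 c : ~ G (le c) (0, true).
  elim/(well_founded_ind lt_wf): c => c IH.
  have split_c x : G (le c) x ->
      G (fun d => lt d c) x \/ D c /\ G (fun d => lt d c) (p c + x).
    elim=> [|z b [d [Dd dc] <-{z}] _ IHb]; first by left; exact: span0.
    case: dc Dd => [->|ltd] Dd; case: IHb => [h|[Dc h]].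
    - by right; split; [|rewrite addrA MB2 add0r].
    - by left.
    - by left; apply: spanS => //; exists d.
    - right; split=> //; rewrite addrCA; apply: spanS => //; by exists d.
  move=> /split_c[/stage[/(congr1 snd)//|[d [_ dc]]]|[Dc /proj1]].
    exact: IH.
  by rewrite /= addr0; exact: indep.
have Gno : ~ G setT (0, true).
  move=> /stage[/(congr1 snd)//|[c _]]; exact: no1.
have [||||phi [phiD phi0 phi1]] := @separating_character _ (G setT) (0, true).
- exact: MB2.
- exact: span0.
- move=> x z; exact: spanD.
- by [].
exists (fun a => phi (a, false)) => [a b|c Dc]; first by rewrite -phiD.
have -> : (u c, false) = (u c, y c) + (0, y c).
  congr pair; rewrite /= ?addr0//; exact/esym/addbb.
rewrite phiD phi0; last by apply: span_incl; exists c.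
case: (y c) => //.
by have := phi0 _ (span0 _).
Qed.

(** * Functionals taking prescribed values *)

(** A sequence of finite subsets of nat, listed without repetition, whose union
    is infinite. *)
Definition admissible (b : nat -> seq nat) :=
  (forall n, uniq (b n)) /\
  forall N, exists n, exists2 j, j \in b n & (N <= j)%N.

(** The sequence of the sums modulo 2 of [v] over the finite sets [b n]. *)
Definition sums (b : nat -> seq nat) (v : nat -> bool) : nat -> bool :=
  fun n => \sum_(j <- b n) v j.

(** A vector extending the finite pattern given by [w0] and [N0], and escaping
    countably many prescribed sequences of sums. *)
Lemma generic_vector (b : nat -> nat -> seq nat) (d : nat -> nat -> bool)
    (w0 : nat -> bool) (N0 : nat) :
  exists v : nat -> bool, (forall i, (i < N0)%N -> v i = w0 i) /\
    forall k, admissible (b k) -> sums (b k) v <> d k.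
Proof.
pose st := (nat * (nat -> bool))%type.
(* A state (N, w) stands for the finite vector w 0, ..., w (N - 1).  One step
   extends it so as to falsify the k-th equation: if it holds for w, flip w at
   a position beyond N which occurs in some b k n. *)
have /choice[F FP] : forall ks : nat * st, exists s' : st,
    [/\ (ks.2.1 < s'.1)%N, forall i, (i < ks.2.1)%N -> s'.2 i = ks.2.2 i &
     admissible (b ks.1) -> exists n,
       (forall j, j \in b ks.1 n -> (j < s'.1)%N) /\
       sums (b ks.1) s'.2 n <> d ks.1 n].
  move=> [k [N w]] /=.
  have [[bU bN]|nb] := pselect (admissible (b k)); last first.
    by exists (N.+1, w).
  have [n [j jb Nj]] := bN N.
  pose w' := if sums (b k) w n == d k n then fun i => w i + (i == j) else w.
  exists ((N + \max_(i <- b k n) i).+1, w'); split => /=.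
  - by rewrite ltnS leq_addr.
  - move=> i iN; rewrite /w'; case: ifP => // _.
    by rewrite (_ : (i == j) = false) ?addr0 //; apply/eqP => ij;
      rewrite ij ltnNge Nj in iN.
  - move=> _; exists n; split.
      move=> i ib; rewrite ltnS (leq_trans _ (leq_addl _ _))//.
      exact: leq_bigmax_seq.
    rewrite /w'; case: ifPn => [/eqP sd|/eqP//].
    rewrite /sums big_split /= -/(sums (b k) w n) sd.
    have -> : \sum_(i <- b k n) (i == j) = true.
      rewrite (bigD1_seq j) //= eqxx big1 ?addr0 // => i /negPf -> //.
    by case: (d k n).
pose S := fix S k : st := if k is k'.+1 then F (k', S k') else (N0, w0).
have SP k := FP (k, S k).
have Sge k : (k <= (S k).1)%N.
  elim: k => [//|k IH]; have [h _ _] := SP k; exact: leq_ltn_trans IH h.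
have Smono k m i : (k <= m)%N -> (i < (S k).1)%N ->
    (i < (S m).1)%N /\ (S m).2 i = (S k).2 i.
  move=> /subnK <-; elim: (m - k)%N => [//|p IH] iS; have [h1 h2] := IH iS.
  have [/= h3 h4 _] := SP (p + k)%N; split; first exact: ltn_trans h3.
  by rewrite -h2; exact: h4.
(* The state [S i.+1] has length greater than i. *)
pose v i := (S i.+1).2 i.
have vE k i : (i < (S k).1)%N -> v i = (S k).2 i.
  move=> ik; rewrite /v; have [ki|ki] := leqP k i.+1.
    by have [_ ->] := Smono _ _ _ ki ik.
  by have [_ ->] := Smono _ _ i (ltnW ki) (Sge i.+1).
exists v; split; first by move=> i iN; rewrite (vE 0%N).
move=> k bk; have [_ _ /(_ bk)[n [bS Sn]]] := SP k.
move=> /(congr1 (fun f => f n)) E; apply: Sn; rewrite -[RHS]E /sums.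
apply: eq_big_seq => j jb; rewrite (vE k.+1)//; exact: bS.
Qed.

Lemma sumsD b v w : sums b (v + w) = sums b v + sums b w.
Proof. by apply/funext => n; exact: big_split. Qed.

(** The elements [k] of [K] are names for partial numberings [rec k] of [X].
    For each name, each countable family [b] of sequences of finite sets and
    each finite pattern, there is a vector [v] with that pattern satisfying the
    equations imposed by functionals [phi x] which do not depend on these data.
    A code [c] collects the name, the family and the pattern; [V c] is chosen
    by recursion along an order of type omega_1 on the codes, its sums avoiding
    the span of all the sums of the earlier vectors. *)
Lemma prescribed_functionals (X K : Type) (rec : K -> X -> option nat) :
  GCH -> embeds (K * (nat -> nat -> seq nat) * (nat -> bool) * nat) (set nat) ->
  exists phi : X -> (nat -> bool) -> bool,
    (forall x, {morph phi x : a b / a + b}) /\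
    forall k (b : nat -> nat -> seq nat) (w0 : nat -> bool) (N0 : nat),
    exists v : nat -> bool, (forall i, (i < N0)%N -> v i = w0 i) /\
      forall x i, rec k x = Some i -> admissible (b i) ->
        phi x (sums (b i) v) = v i.
Proof.
move=> gch; set C := (K * _ * _ * _)%type => Csmall.
pose kk (c : C) := c.1.1.1; pose bb (c : C) := c.1.1.2.
pose ww (c : C) := c.1.2; pose NN (c : C) := c.2.
have [lt [lt_wf lt_tri lt_count]] := omega1_order gch Csmall.
pose prev c (f : forall d, lt d c -> nat -> bool) : set (nat -> bool) :=
  [set u | exists d, exists dc : lt d c, exists i, u = sums (bb d i) (f d dc)].
have ex_next c (f : forall d, lt d c -> nat -> bool) : exists v : nat -> bool,
    (forall i, (i < NN c)%N -> v i = ww c i) /\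
    forall i, admissible (bb c i) -> ~ span (prev c f) (sums (bb c i) v).
  have [] : exists e : nat -> nat -> bool,
      forall u, span (prev c f) u -> exists n, e n = u.
    apply: span_enum.
    pose G (di : {d | lt d c} * nat) :=
      sums (bb (sval di.1) di.2) (f (sval di.1) (proj2_sig di.1)).
    apply: (@sub_countable _ _ _ (range G)).
      apply: subset_card_le => _ [d [dc [i ->]]].
      by exists (exist _ d dc, i).
    apply: sub_countable (card_image_le _ _) _.
    apply/countable_embeds.
    have [h hI] : embeds {d | lt d c} nat.
      have /countable_embeds := lt_count c; apply: embeds_trans.
      exists (fun d : {d | lt d c} =>
        @SigSub _ _ [set d | lt d c] (sval d) (mem_set (svalP d))).
      by move=> [x xc] [y yc] /(congr1 \val) /= xy; exact: eq_exist.
    exists (fun x => pickle (h (\val x).1, (\val x).2)).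
    move=> x y /(pcan_inj pickleK) [] /hI h1 h2; apply: val_inj.
    exact: injective_projections.
  move=> e eP.
  have [v [v1 v2]] := generic_vector
    (fun k => bb c (odflt (0, 0)%N (unpickle k : option (nat * nat))).1)
    (fun k => e (odflt (0, 0)%N (unpickle k : option (nat * nat))).2)
    (ww c) (NN c).
  exists v; split=> // i ci /eP[n en].
  by have := v2 (pickle (i, n)); rewrite pickleK /= => /(_ ci); rewrite en.
have /choice[nxt nxtP] : forall cf : {c & forall d, lt d c -> nat -> bool},
    exists v : nat -> bool,
    (forall i, (i < NN (projT1 cf))%N -> v i = ww (projT1 cf) i) /\
    forall i, admissible (bb (projT1 cf) i) ->
      ~ span (prev _ (projT2 cf)) (sums (bb (projT1 cf) i) v).
  by move=> [c f]; exact: ex_next.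
pose V : C -> nat -> bool := Fix lt_wf (fun _ => nat -> bool)
  (fun c f => nxt (existT _ c f)).
have VE c : V c = nxt (existT (fun c => forall d, lt d c -> nat -> bool) c
    (fun d _ => V d)).
  rewrite /V Fix_eq // => c' f g fg; congr (nxt (existT _ c' _)).
  by apply: functional_extensionality_dep => d; apply: funext => dc; exact: fg.
have V1 c i : (i < NN c)%N -> V c i = ww c i.
  by move=> ic; rewrite VE; exact: (nxtP (existT _ c (fun d _ => V d))).1.
have V2 c i : admissible (bb c i) ->
    ~ span [set u | exists d, lt d c /\ exists i, u = sums (bb d i) (V d)]
      (sums (bb c i) (V c)).
  move=> ci; have := (nxtP (existT _ c (fun d _ => V d))).2 i ci.
  rewrite -VE /=.
  apply: contra_not => h; rewrite [X in span X _](_ : _ =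
    [set u | exists d, lt d c /\ exists i, u = sums (bb d i) (V d)])//.
  apply/seteqP; split=> u.
    by move=> [d [dc [j ->]]]; exists d; split=> //; exists j.
  by move=> [d [dc [j ->]]]; exists d, dc, j.
suff /choice[phi phiP] : forall x, exists f : (nat -> bool) -> bool,
    {morph f : a b / a + b} /\ forall c i, rec (kk c) x = Some i ->
    admissible (bb c i) -> f (sums (bb c i) (V c)) = V c i.
  exists phi; split=> [x|k b w0 N0]; first exact: (phiP x).1.
  exists (V (k, b, w0, N0)); split=> [i iN|x i xi bi]; first by rewrite V1.
  exact: (phiP x).2 (k, b, w0, N0) i xi bi.
move=> x.
pose ix c := odflt 0%N (rec (kk c) x).
pose D := [set c | rec (kk c) x = Some (ix c) /\ admissible (bb c (ix c))].
have M2 (a : nat -> bool) : a + a = 0 by apply/funext => n; exact: addbb.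
have [|f fD fP] := @independent_extension C lt D (nat -> bool)
    (fun c => sums (bb c (ix c)) (V c)) (fun c => V c (ix c)) M2 lt_wf lt_tri.
- move=> c [_ Dc]; apply: contra_not (V2 c _ Dc).
  elim=> [|a z [d [_ dc] <-] _ IH].
    exact: span0.
  by apply: spanS => //; exists d; split=> //; exists (ix d).
- exists f; split=> // c i ci bi; have ixE : ix c = i by rewrite /ix ci.
  by rewrite -ixE; apply: fP; rewrite /D /= ixE.
Qed.

(** * The index set and the independence of coordinates *)

(** Coordinates of the group.  In [node Y F a], the set [Y] is a label whose
    sole purpose is to provide 2^c nodes with the same [F] and [a]; these two
    data encode the sequence [members] of finite sets of coordinates. *)
Inductive tree : Type :=
  | leaf of nat
  | node of set (set nat) & (nat -> seq nat) & (nat -> tree).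

HB.instance Definition _ := gen_eqMixin tree.
HB.instance Definition _ := gen_choiceMixin tree.
HB.instance Definition _ := isPointed.Build tree (leaf 0).

(** The n-th finite set of coordinates attached to a node; empty for a leaf. *)
Definition members (x : tree) (n : nat) : seq tree :=
  if x is node _ F a then [seq a j | j <- F n] else [::].

(** The coordinates subject to an equation: those whose sequence of finite sets
    has infinite union.  Leaves are not constrained. *)
Definition constrained (x : tree) : Prop :=
  (forall n, uniq (members x n)) /\
  forall s : seq tree, exists n, exists2 y, y \in members x n & y \notin s.

(** A tree as a subset of a set of cardinality c: the pairs of a path and of a
    piece of information on the node reached by it, which is an element of its
    label, the number of the leaf, or a value of [F]. *)
Fixpoint signature (x : tree) (p : seq nat) (q : set nat + nat + nat * seq nat)
    : Prop :=
  match x, p with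
  | leaf n, [::] => q = inl (inr n)
  | leaf _, _ :: _ => False
  | node Y F _, [::] =>
      match q with
      | inl (inl Z) => Y Z
      | inl (inr _) => False
      | inr (n, s) => s = F n
      end
  | node _ _ a, j :: p => signature (a j) p q
  end.

Lemma signature_inj (x y : tree) :
  (forall p q, signature x p q <-> signature y p q) -> x = y.
Proof.
elim: x y => [n|Y F a IH] [m|Z G b] h.
- by have /= [/(_ erefl)[->]] := h [::] (inl (inr n)).
- by have /= [/(_ erefl)] := h [::] (inl (inr n)).
- by have /= [_ /(_ erefl)] := h [::] (inl (inr m)).
- have -> : Y = Z.
    apply/seteqP; split=> A YA; have /= [h1 h2] := h [::] (inl (inl A)).
      exact: h1.
    exact: h2.
  have -> : F = G.
    by apply/funext => n; have /= [/(_ erefl)] := h [::] (inr (n, F n)).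
  congr node; apply/funext => j; apply: IH => p q; exact: (h (j :: p) q).
Qed.

Lemma embeds_set (T U : Type) : embeds T U -> embeds (set T) (set U).
Proof.
move=> [f fI]; exists (fun A => f @` A) => A B /seteqP[h1 h2].
apply/seteqP; split=> x Ax.
  by have [|y By /fI <-] := h1 (f x); first by exists x.
by have [|y By /fI <-] := h2 (f x); first by exists x.
Qed.

Lemma embeds_countable_sets (I : countType) : embeds (set I) (set nat).
Proof. by apply: embeds_set; exists pickle; exact: (pcan_inj pickleK). Qed.

Lemma embeds_prod (T U : Type) : embeds T (set nat) -> embeds U (set nat) ->
  embeds (T * U) (set nat).
Proof.
move=> [f fI] [g gI].
apply: (@embeds_trans _ (set (nat + nat)) _ _ (embeds_countable_sets _)).
exists (fun tu =>
  [set z | match z with inl n => f tu.1 n | inr n => g tu.2 n end]).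
move=> x y /seteqP[h1 h2]; apply: injective_projections.
  apply: fI; apply/seteqP.
  by split=> n ?; [exact: (h1 (inl n))|exact: (h2 (inl n))].
apply: gI; apply/seteqP.
by split=> n ?; [exact: (h1 (inr n))|exact: (h2 (inr n))].
Qed.

Lemma embeds_nat_fun (T : Type) : embeds T (set nat) ->
  embeds (nat -> T) (set nat).
Proof.
move=> [f fI].
apply: (@embeds_trans _ (set (nat * nat)) _ _ (embeds_countable_sets _)).
exists (fun h => [set z | f (h z.1) z.2]) => h k /seteqP[h1 h2].
apply/funext => n; apply: fI.
by apply/seteqP; split=> m ?; [exact: (h1 (n, m))|exact: (h2 (n, m))].
Qed.

Lemma embeds_countType (T : countType) : embeds T (set nat).
Proof.
exists (fun x => [set pickle x]) => x y /seteqP[/(_ _ erefl) /= h _].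
exact: (pcan_inj pickleK).
Qed.

Lemma embeds_sum (T U : Type) : embeds T (set nat) -> embeds U (set nat) ->
  embeds (T + U) (set nat).
Proof.
move=> [f fI] [g gI].
have h : embeds (bool * set nat) (set nat).
  exact: embeds_prod (embeds_countType _) (embeds_refl _).
apply: embeds_trans h.
exists (fun z => match z with inl t => (true, f t) | inr u => (false, g u) end).
by move=> [t|u] [t'|u'] //= [] => [/fI|/gI] ->.
Qed.

(** A name for a partial numbering of the trees: countably many points [k.1 m]
    at which signatures are tested, and for each number [i] the row [k.2 i] of
    answers expected from the tree number [i]. *)
Definition recognizer : Type :=
  (nat -> seq nat * (set nat + nat + nat * seq nat)) * (nat -> nat -> bool).

(** The number attributed to a tree; an arbitrary matching row is chosen, and
    the rows are pairwise distinct in the only case of interest. *)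
Definition recognize (k : recognizer) (x : tree) : option nat :=
  let good i := forall m, `[< signature x (k.1 m).1 (k.1 m).2 >] = k.2 i m in
  if pselect (exists i, good i) is left ex then Some (sval (cid ex)) else None.

(** Any injective sequence of trees is numbered by one of the c recognizers:
    test the signatures at points separating its terms two by two. *)
Lemma recognize_sequence (e : nat -> tree) : injective e ->
  exists k, forall i, recognize k (e i) = Some i.
Proof.
move=> eI.
have /choice[r rP] : forall m,
    exists pq : seq nat * (set nat + nat + nat * seq nat),
    forall i j, m = pickle (i, j) -> i <> j ->
    ~ (signature (e i) pq.1 pq.2 <-> signature (e j) pq.1 pq.2).
  move=> m; have [[[i j] /= [mij ij]]|h] :=
      pselect (exists ij : nat * nat, m = pickle ij /\ ij.1 <> ij.2).
    apply: contrapT => h; apply: ij; apply: eI; apply: signature_inj => p q.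
    apply: contrapT => hpq; apply: h; exists (p, q) => i' j'.
    by rewrite mij => /(pcan_inj pickleK)[<- <-].
  by exists ([::], inl (inr 0%N)) => i j mij ij; case: h; exists (i, j).
pose t i m := `[< signature (e i) (r m).1 (r m).2 >].
exists (r, t) => i; rewrite /recognize; case: pselect => [ex|]; last first.
  by case; exists i.
case: cid => j /= jP; congr Some; apply: contrapT => ij.
apply: (rP _ i j erefl (nesym ij)).
have E := jP (pickle (i, j)); rewrite /t /= in E.
by split=> h; apply/asboolP; [rewrite -E|rewrite E]; apply/asboolP.
Qed.

Lemma recognizer_small : embeds recognizer (set nat).
Proof.
apply: embeds_prod; apply: embeds_nat_fun.
  apply: embeds_prod; first exact: embeds_countType.
  apply: embeds_sum (embeds_countType _).
  exact: embeds_sum (embeds_refl _) (embeds_countType _).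
exact/embeds_nat_fun/embeds_countType.
Qed.

(** The node reached along a path of child numbers; paths stop at leaves. *)
Fixpoint descendant (x : tree) (p : seq nat) : tree :=
  match x, p with
  | node _ _ a, j :: p => descendant (a j) p
  | _, _ => x
  end.

Lemma descendant_rcons Y F a x p j : descendant x p = node Y F a ->
  descendant x (rcons p j) = a j.
Proof.
elim: p x => [|i p IH] [n|Y' F' a'] //= h.
  by case: h => _ _ ->; case: (a j).
exact: IH h.
Qed.

(** Any finite set of trees is contained in a countably infinite set of trees
    closed under children.  All leaves are included to make it infinite. *)
Lemma hereditary_enum (s : seq tree) : exists e : nat -> tree,
  [/\ injective e, forall x, x \in s -> exists i, e i = x &
   forall i Y F a, e i = node Y F a -> forall j, exists k, e k = a j].
Proof.
pose E := [set y | exists t p,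
  (t \in s \/ exists n, t = leaf n) /\ y = descendant t p].
have Ecount : countable E.
  pose f (np : (nat + nat) * seq nat) :=
    descendant
      (match np.1 with inl i => nth (leaf 0) s i | inr n => leaf n end) np.2.
  apply: (@sub_countable _ _ _ (range f)); last first.
    exact: sub_countable (card_image_le _ _) (countableP _).
  apply: subset_card_le => _ [t [p [[ts|[n ->]] ->]]].
    by exists (inl (index t s), p) => //; rewrite /f /= nth_index.
  by exists (inr n, p).
have Einf : infinite_set E.
  apply/infiniteP/card_le_embeds.
  have lE n : leaf n \in E.
    by apply/mem_set; exists (leaf n), [::]; split=> //; right; exists n.
  exists (fun n => SigSub (lE (\val n))) => x y /(congr1 \val) /= [].
  exact: val_inj.
have /card_set_bijP[e [eE eI eS]] : [set: nat] #= E.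
  by apply/Cantor_Bernstein => //; exact/infiniteP.
exists e; split.
- by move=> i j; apply: eI; rewrite in_setT.
- move=> x xs; have [|i _ <-] := eS x; last by exists i.
  by exists x, [::]; split; [left|case: (x)].
- move=> i Y F a ei j; have [t [p [ht yE]]] := eE i I.
  have [|k _ <-] := eS (a j); last by exists k.
  exists t, (rcons p j); split=> //; apply/esym/descendant_rcons.
  by rewrite -yE ei.
Qed.

(** The group of all solutions of the equations imposed by [phi]. *)
Definition solutions (phi : tree -> (nat -> bool) -> bool) :
    set (tree -> bool) :=
  [set v | forall x, constrained x ->
     v x = phi x (fun n => \sum_(y <- members x n) v y)].

(** The functionals can be chosen so that any coordinate is independent, on the
    group of solutions, of any finite set of other coordinates. *)
Lemma free_coordinates : GCH -> exists phi : tree -> (nat -> bool) -> bool,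
  (forall x, {morph phi x : a b / a + b}) /\
  forall (x : tree) (s : seq tree), x \notin s ->
    exists v, [/\ solutions phi v, v x = true &
      forall y, y \in s -> v y = false].
Proof.
move=> gch.
have [|phi [phiD phiP]] :=
    @prescribed_functionals tree recognizer recognize gch.
  apply: embeds_prod (embeds_countType _).
  apply: embeds_prod; last exact/embeds_nat_fun/embeds_countType.
  apply: embeds_prod; first exact: recognizer_small.
  exact/embeds_nat_fun/embeds_nat_fun/embeds_countType.
exists phi; split=> // x s xs.
have [e [eI es eC]] := hereditary_enum (x :: s).
have [k kP] := recognize_sequence eI.
have /choice[idx idxP] : forall y, exists i, (exists j, e j = y) -> e i = y.
  move=> y; have [[i iy]|h] := pselect (exists j, e j = y); first by exists i.
  by exists 0%N => /h.
have idxK i : idx (e i) = i by apply: eI; apply: idxP; exists i.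
pose b i n := [seq idx y | y <- members (e i) n].
have [v [v1 v2]] := phiP k b (fun i => e i == x) (\max_(y <- x :: s) idx y).+1.
have vs y : y \in x :: s -> v (idx y) = (y == x).
  move=> ys; rewrite v1 ?ltnS; last exact: leq_bigmax_seq.
  by rewrite idxP//; exact: es.
(* [v] gives the values on the range of [e]; elsewhere the equations define
   [w] by recursion on trees. *)
pose E y := exists j, e j = y.
pose fix w y : bool :=
  if `[< E y >] then v (idx y) else
  match y with
  | leaf _ => false
  | node Y F a => phi (node Y F a) (fun n => \sum_(j <- F n) w (a j))
  end.
have wE y : E y -> w y = v (idx y).
  by case: y => [n|Y F a] Ey /=; rewrite asboolT.
exists w; split.
- move=> y yc; have [Ey|nEy] := pselect (E y); last first.
    case: y yc nEy => [n [_ /(_ [::])[m [z]]] //|Y F a _ nEy].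
    rewrite [LHS]/= asboolF //; congr phi; apply/funext => n.
    by rewrite /members big_map.
  rewrite wE //; case: Ey => i <-{y} in yc *; rewrite idxK.
  have Emem n z : z \in members (e i) n -> E z.
    case eiE: (e i) => [|Y F a] //= /mapP[j _ ->]; exact: eC eiE j.
  rewrite -(v2 (e i) i (kP i)); last first.
    case: yc => [yU yN]; split=> [n|N].
      rewrite map_inj_in_uniq // => p q /Emem/idxP pE /Emem/idxP qE pq.
      by rewrite -pE -qE pq.
    have [n [y yn yN']] := yN [seq e j | j <- iota 0 N].
    exists n, (idx y); first exact: map_f.
    rewrite leqNgt; apply: contra yN' => yN'; apply/mapP; exists (idx y).
      by rewrite mem_iota.
    exact/esym/idxP/(Emem n).
  congr phi; apply/funext => n; rewrite /sums /b big_map.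
  by apply: eq_big_seq => z /Emem zE; rewrite wE.
- rewrite wE; last by apply: es; rewrite mem_head.
  by rewrite vs ?mem_head ?eqxx.
- move=> y ys; have ys' : y \in x :: s by rewrite inE ys orbT.
  rewrite wE; last exact: es.
  by rewrite vs //; apply/eqP => yx; rewrite -yx ys in xs.
Qed.

(** * Quotient groups and groups of functions *)

Section zmod_closed_of_set.
Context (G : zmodType) (A : set G).

(** A set containing 0 and closed under subtraction, bundled as a subgroup. *)
Definition subgroup_of (A0 : A 0) (AB : forall x y, A x -> A y -> A (x - y)) :
  {pred G} := [pred x | x \in A].

Context (A0 : A 0) (AB : forall x y, A x -> A y -> A (x - y)).

Let closedB : zmod_closed (subgroup_of A0 AB).
Proof.
split; first exact/mem_set.
by move=> x y xA yA; apply/mem_set; apply: AB; apply/set_mem.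
Qed.

HB.instance Definition _ :=
  GRing.isZmodClosed.Build G (subgroup_of A0 AB) closedB.

Lemma subgroup_ofE : [set` subgroup_of A0 AB] = A.
Proof. by apply/seteqP; split=> x /=; rewrite inE. Qed.

End zmod_closed_of_set.

Section quotient_map.
Context (G : topologicalZmodType) (N : zmodClosed G).
Local Open Scope quotient_scope.

(** The canonical projection of [G] onto its quotient by [N]. *)
Definition quotient_map : G -> quotient_group N := \pi_(Quotient.quot N).

Lemma quotient_map_surj q : exists x, quotient_map x = q.
Proof. by exists (repr (q : Quotient.quot N)); exact: reprK. Qed.

Lemma quotient_map_eq x y : quotient_map x = quotient_map y <-> x - y \in N.
Proof. by rewrite Quotient.idealrBE; split => [h|/eqP //]; apply/eqP. Qed.

Lemma open_quotient (U : set (quotient_group N)) :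
  open U = open (quotient_map @^-1` U).
Proof. by []. Qed.

End quotient_map.

Section pointwise_group.
Context (T : eqType) (S : zmodClosed (T -> bool)).

(** A group [S] of functions from [T] to bool, with the topology of pointwise
    convergence: the neighbourhoods of [v] are the sets containing all the
    functions that agree with [v] on some finite set. *)
Definition pointwise_group : Type := {f : T -> bool | f \in S}.
Local Notation V := pointwise_group.

HB.instance Definition _ := [isSub of V for @sval _ _].
HB.instance Definition _ := [Choice of V by <:].
HB.instance Definition _ := [SubChoice_isSubZmodule of V by <:].

Definition agree (s : seq T) (u v : V) : Prop :=
  forall y, y \in s -> val u y = val v y.

Definition pointwise_nbhs (v : V) : set_system V :=
  [set A | exists s : seq T, forall u, agree s u v -> A u].

HB.instance Definition _ := hasNbhs.Build V pointwise_nbhs.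

Let nbhs_filter (v : V) : ProperFilter (nbhs v).
Proof.
apply: Build_ProperFilter_ex; first by move=> A [s sA]; exists v; exact: sA.
split.
- by exists [::].
- move=> A B [s sA] [t tB]; exists (s ++ t) => u h.
  by split; [apply: sA|apply: tB] => y ys; apply: h; rewrite mem_cat ys ?orbT.
- by move=> A B AB [s sA]; exists s => u /sA /AB.
Qed.

Let nbhs_singleton (v : V) (A : set V) : nbhs v A -> A v.
Proof. by move=> [s sA]; exact: sA. Qed.

Let nbhs_nbhs (v : V) (A : set V) : nbhs v A -> nbhs v (nbhs^~ A).
Proof.
move=> [s sA]; exists s => u uv; exists s => w wu; apply: sA => y ys.
by rewrite wu // uv.
Qed.

HB.instance Definition _ :=
  Nbhs_isNbhsTopological.Build V nbhs_filter nbhs_singleton nbhs_nbhs.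

Let sub_continuous : continuous (fun z : V * V => z.1 - z.2).
Proof.
move=> [u v] A [s sA]; exists ([set w | agree s w u], [set w | agree s w v]).
  by split; exists s.
move=> [u' v'] /= [hu hv]; apply: sA => y ys.
by rewrite !raddfB /= !fctE hu // hv.
Qed.

HB.instance Definition _ :=
  PreTopologicalNmodule_isTopologicalZmodule.Build V sub_continuous.

Lemma pointwise_hausdorff : hausdorff_space V.
Proof.
move=> u v uv; apply: val_inj; apply/funext => y.
have nb (x : V) : nbhs x [set w | agree [:: y] w x] by exists [:: y].
have [w [/= wu wv]] := uv _ _ (nb u) (nb v).
by rewrite -wu ?wv // mem_head.
Qed.

Lemma pointwise_precompact : precompact_group V.
Proof.
move=> U [s sU].
have /choice[g gP] : forall p : (size s).-tuple bool, exists v : V,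
    forall u : V, map (val u) s = p -> agree s u v.
  move=> p; have [[v vp]|h] := pselect (exists v : V, map (val v) s = p).
    exists v => u up y ys; move: ys => /(nthP y)[i si <-].
    by rewrite -(nth_map y false) // up -vp (nth_map y).
  by exists 0 => u up; case: h; exists u.
exists (range g); first exact/finite_image/finite_finset.
apply/seteqP; split=> // x _.
have sz : size (map (val x) s) == size s by rewrite size_map.
exists (g (Tuple sz)); first by exists (Tuple sz).
exists (x - g (Tuple sz)); last by rewrite addrC subrK.
apply: sU => y ys; rewrite raddfB raddf0 /= fctE [val x y](gP (Tuple sz)) //.
exact: addbb.
Qed.

(** The character given by the finite set [t] vanishes on [N]. *)
Definition annihilates (t : seq T) (N : set V) : Prop :=
  forall u, N u -> \sum_(y <- t) val u y = false.

(** Closed subgroups are intersections of kernels of characters.  If [v] is not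
    in [N], its restriction to some finite set [s] is not the restriction of an
    element of [N]; a character separating it from these restrictions depends
    on the coordinates in [s] only, hence is a sum of coordinates. *)
Lemma dual_closed (N : zmodClosed V) (v : V) : closed [set` N] -> v \notin N ->
  exists t, [/\ uniq t, annihilates t [set` N] & \sum_(y <- t) val v y = true].
Proof.
move=> Ncl vN.
have [s sP] : nbhs v (~` [set` N]).
  by apply: open_nbhs_nbhs; split; [exact: closed_openC|exact/negP].
have M2 (f : T -> bool) : f + f = 0 by apply/funext => y; exact: addbb.
pose Gam := [set f : T -> bool |
  exists2 u : V, u \in N & forall y, y \in s -> f y = val u y].
have [|||phi [phiD phi0 phi1]] := @separating_character _ Gam (val v) M2.
- by exists 0; [exact: rpred0|].
- move=> f g [u uN fu] [w wN gw]; exists (u + w); first exact: rpredD.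
  by move=> y ys; rewrite raddfD /= fctE fu // gw.
- by move=> [u uN vu]; apply: (sP u) => // y ys; rewrite vu.
pose delta y : T -> bool := fun z => z == y.
pose t := [seq y <- undup s | phi (delta y)].
have phi_0 : phi 0 = false by apply: phi0; exists 0; [exact: rpred0|].
have phiE f : phi f = \sum_(y <- t) f y.
  pose g := \sum_(y <- undup s) (if f y then delta y else 0).
  have phig : phi g = \sum_(y <- t) f y.
    rewrite /g (big_morph phi phiD phi_0) /t big_filter [RHS]big_mkcond /=.
    by apply: eq_bigr => y _; case: (f y); case: ifP => // _; rewrite ?phi_0.
  rewrite -phig; have gE : {in s, g =1 f}.
    move=> z zs; rewrite /g fct_sumE (bigD1_seq z) ?mem_undup ?undup_uniq //=.
    rewrite big1 ?addr0; first by rewrite /delta; case: (f z); rewrite ?eqxx.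
    by move=> y /negPf yz; rewrite /delta; case: (f y) => //=; rewrite eq_sym.
  have : phi (f + g) = false.
    apply: phi0; exists 0; first exact: rpred0.
    by move=> z zs; rewrite fctE gE //; exact: addbb.
  by rewrite phiD; case: (phi f); case: (phi g).
exists t; split; first by rewrite filter_uniq // undup_uniq.
- by move=> u uN; rewrite -phiE; apply: phi0; exists u.
- by rewrite -phiE.
Qed.

(** Otherwise all the characters vanishing on [N] would depend on finitely many
    coordinates only, and [N] would have finite index. *)
Lemma infinite_annihilator (N : zmodClosed V) : closed [set` N] ->
  infinite_set [set: quotient_group N] ->
  forall s : seq T, exists t, [/\ uniq t, annihilates t [set` N] &
    exists2 y, y \in t & y \notin s].
Proof.
move=> Ncl Ninf s; apply: contrapT => h; apply: Ninf.
have tP t : uniq t -> annihilates t [set` N] -> {subset t <= s}.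
  move=> tU tN y yt; apply: contrapT => /negP ys; apply: h; exists t.
  by split=> //; exists y.
have /choice[r rP] := @quotient_map_surj V N.
have sz q : size (map (val (r q)) s) == size s by rewrite size_map.
apply: (@card_le_finite _ _ _ [set: (size s).-tuple bool]); last first.
  exact: finite_finset.
apply/embedsP; exists (fun q => Tuple (sz q)) => p q /(congr1 val) /= pq.
rewrite -(rP p) -(rP q); apply/quotient_map_eq; apply: contrapT => /negP.
move=> /(dual_closed Ncl)[t [tU tN]].
rewrite big_seq big1 // => y /(tP _ tU tN) ys.
have : val (r p) y = val (r q) y.
  by move: pq => /eq_in_map; apply.
by rewrite raddfB /= fctE => ->; exact: addbb.
Qed.

End pointwise_group.

(** * A group without small infinite quotients *)

(** Every sequence of finite sets of trees occurs in a node: enumerate all of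
    their elements, the pair (n, k) standing for the k-th element of [b n]. *)
Lemma node_of_sequence (b : nat -> seq tree) :
  exists F a, forall Y, members (node Y F a) =1 b.
Proof.
pose a m := let nk := odflt (0, 0)%N (unpickle m : option (nat * nat)) in
  nth (leaf 0) (b nk.1) nk.2.
exists (fun n => [seq pickle (n, k) | k <- iota 0 (size (b n))]), a => Z n /=.
rewrite -map_comp -[RHS](mkseq_nth (leaf 0)) /mkseq; apply: eq_map => k /=.
by rewrite /a pickleK.
Qed.

Lemma no_small_quotient : GCH -> exists G : topologicalZmodType,
  [/\ hausdorff_space G, precompact_group G, infinite_set [set: G] &
  forall N : zmodClosed G, closed [set` N] ->
    infinite_set [set: quotient_group N] ->
    (forall D : set (quotient_group N), dense D -> ~ countable D) /\
    (forall B : set (set (quotient_group N)), basis B ->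
       ~ (B #<= [set: set nat]))].
Proof.
move=> gch; have [phi [phiD free]] := free_coordinates gch.
have phi0 x : phi x 0 = false.
  by have := phiD x 0 0; rewrite addr0; case: (phi x 0).
have sol0 : solutions phi 0.
  move=> x _; rewrite -[LHS](phi0 x); congr phi; apply/funext => n.
  by rewrite big1.
have solB v w : solutions phi v -> solutions phi w -> solutions phi (v - w).
  move=> vP wP x xc; rewrite -[LHS]/(v x + w x) vP // wP //.
  have -> : (fun n => \sum_(y <- members x n) (v - w) y) =
    (fun n => \sum_(y <- members x n) v y) +
    (fun n => \sum_(y <- members x n) w y).
    by apply/funext => n; exact: big_split.
  by rewrite phiD.
pose S := subgroup_of sol0 solB.
pose G := pointwise_group S.
have inG v : solutions phi v -> exists u : G, val u = v.
  by move=> vP; exists (exist _ v (mem_set vP)).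
have freeG (x : tree) (s : seq tree) : x \notin s ->
    exists2 u : G, val u x = true & forall y, y \in s -> val u y = false.
  by move=> xs; have [v [/inG[u <-] ux us]] := free x s xs; exists u.
exists G; split; [exact: pointwise_hausdorff|exact: pointwise_precompact| |].
  apply/infiniteP/embedsP.
  have /choice[v vP] : forall n : nat, exists u : G, val u (leaf n) = true /\
      forall m, (m < n)%N -> val u (leaf m) = false.
    move=> n; have [|u un us] := freeG (leaf n) [seq leaf m | m <- iota 0 n].
      apply/mapP => -[m]; rewrite mem_iota => mn [nm].
      by rewrite nm ltnn andbF in mn.
    by exists u; split=> // m mn; apply: us; rewrite map_f // mem_iota.
  exists v => m n mn; have [mn'|mn'|//] := ltngtP m n.
    by have [_ /(_ _ mn')] := vP n; rewrite -mn (vP m).1.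
  by have [_ /(_ _ mn')] := vP m; rewrite mn (vP n).1.
move=> N Ncl Ninf; pose Q := quotient_group N.
have annP := infinite_annihilator Ncl Ninf.
(* The coordinates occurring in the characters that vanish on N. *)
pose U := [set y : tree |
  exists t, [/\ uniq t, annihilates t [set` N] & y \in t]].
have Uinf : infinite_set U.
  move=> /finite_seqP[s Us]; have [t [tU tN [y yt]]] := annP s.
  apply/negP/negPn; have : U y by exists t.
  by rewrite Us.
have [y yI yU] : exists2 y : nat -> tree, injective y & forall n, U (y n).
  have /infiniteP/card_le_embeds[f fI] := Uinf.
  exists (fun n => val (f (to_setT n))) => [m n /val_inj/fI/(congr1 val)//|n].
  exact/set_mem/valP.
have /choice[b bP] : forall n, exists t,
    [/\ uniq t, annihilates t [set` N] & y n \in t] by move=> n; exact: yU.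
have [F [a bE]] := node_of_sequence b.
(* The nodes [xi Y] share the sequence [b], and each of them vanishes on N. *)
pose xi Y := node Y F a.
have xic Y : constrained (xi Y).
  split=> [n|s]; first by rewrite bE; have [] := bP n.
  have [n yn] : exists n, y n \notin s.
    apply: contrapT => h; have : infinite_set (range y).
      apply/infiniteP; have := inj_card_eq (in2W yI : {in [set: nat] &, _}).
      by move=> /card_eqPle[].
    apply; apply: (@sub_finite_set _ _ [set` s]); last exact: finite_seq.
    by move=> _ [n _ <-] /=; apply: contrapT => /negP ns; apply: h; exists n.
  by exists n, (y n) => //; rewrite bE; have [] := bP n.
have xiN Y (u : G) : u \in N -> val u (xi Y) = false.
  move=> uN; have uS : solutions phi (val u) by exact/set_mem/(valP u).
  rewrite uS // -[RHS](phi0 (xi Y)); congr phi; apply/funext => n.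
  by rewrite bE; have [_ bN _] := bP n; exact: bN.
(* Evaluation at [xi Y], seen as a character of the quotient, is
   [fun q => val (r q) (xi Y)]. *)
have /choice[r rP] := @quotient_map_surj G N.
have rE Y u : val (r (quotient_map N u)) (xi Y) = val u (xi Y).
  have /quotient_map_eq/(xiN Y) := rP (quotient_map N u).
  by rewrite raddfB; exact: subr0_eq.
have openx x c : open [set u : G | val u x = c].
  rewrite openE => u <-; exists [:: x] => w h; exact/h/mem_head.
have openQ (Y Z : set (set nat)) c d : open [set q : Q |
    val (r q) (xi Y) = c /\ val (r q) (xi Z) = d].
  rewrite open_quotient (_ : _ @^-1` _ =
    [set u | val u (xi Y) = c] `&` [set u | val u (xi Z) = d]).
    by apply: openI; exact: openx.
  by apply/seteqP; split=> u /=; rewrite !rE.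
have xi_eq Y Z : xi Y = xi Z -> Y = Z by case.
(* First density: a subset of D determines Y.  Then weight: if W is a basic
   neighbourhood of 0 on which the character xi Y vanishes, then xi Y is one of
   the finitely many coordinates restricted by W. *)
split=> [D Dd /countable_embeds Dc|B [Bo Bb] /card_le_embeds Bc].
  apply: (@not_embeds_set (set nat)).
  apply: (@embeds_trans _ (set D)).
    exists (fun Y => [set d : D | val (r (val d)) (xi Y)]) => Y Z YZ.
    apply: contrapT => nYZ; have [|u uY uZ] := freeG (xi Y) [:: xi Z].
      by rewrite inE; apply/eqP => /xi_eq.
    have [|d [[/= dY dZ] Dd']] := Dd _ _ (openQ Y Z true false).
      exists (quotient_map N u) => /=; rewrite !rE uY uZ ?mem_head //.
    have /seteqP[/(_ (SigSub (mem_set Dd')))/= + _] := YZ.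
    by rewrite dY dZ => /(_ isT).
  exact: embeds_set.
apply: (@not_embeds_set (set nat)).
have {}Bc : embeds B (set nat).
  by apply: embeds_trans Bc _; exists val; exact: val_inj.
apply: (@embeds_trans _ (B * nat)); last first.
  exact: embeds_prod Bc (embeds_countType _).
have /choice[s sP] : forall W : B, exists s : seq tree,
    val W (quotient_map N 0) ->
    forall u : G, (forall y, y \in s -> val u y = false) ->
    val W (quotient_map N u).
  move=> W.
  have [W0|] := pselect (val W (quotient_map N 0)); last by exists [::].
  have oW : open (quotient_map N @^-1` val W).
    by rewrite -open_quotient; apply: Bo; exact/set_mem/(valP W).
  have [s sW] : nbhs (0 : G) (quotient_map N @^-1` val W).
    exact: open_nbhs_nbhs.
  exists s => _ u us; apply: sW => z zs; rewrite us //.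
have /choice[W WP] : forall Y, exists W : B, val W (quotient_map N 0) /\
    forall q, val W q -> val (r q) (xi Y) = false.
  move=> Y; have nb : nbhs (quotient_map N 0)
      [set q : Q | val (r q) (xi Y) = false /\ val (r q) (xi Y) = false].
    apply: open_nbhs_nbhs; split; first exact: openQ.
    by rewrite /= rE.
  have [W [BW W0] Wsub] := Bb _ _ nb.
  exists (SigSub (mem_set BW)); split=> //= q /Wsub[] //.
have xis Y : xi Y \in s (W Y).
  apply: contrapT => /negP /freeG[u uY us]; have [W0 WY] := WP Y.
  by have := WY _ (sP _ W0 _ us); rewrite rE uY.
exists (fun Y => (W Y, index (xi Y) (s (W Y)))) => Y Z [WYZ iYZ].
apply: xi_eq; rewrite -(nth_index (leaf 0) (xis Y)) iYZ WYZ.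
exact: nth_index.
Qed.

(** * Quotients of cardinality at most the continuum *)

Lemma nbhs_difference (G : topologicalZmodType) (U : set G) : nbhs 0 U ->
  exists2 W : set G, nbhs 0 W & forall x y, W x -> W y -> U (x - y).
Proof.
move=> U0; have := @sub_continuous G (0, 0) U.
rewrite /= subrr => /(_ U0)[[A B] /= [A0 B0] AB].
exists (A `&` B); first exact: filterI.
by move=> x y [Ax _] [_ By]; exact: (AB (x, y)).
Qed.

(** The case of a precompact group: some infinite quotient by a closed subgroup
    has cardinality at most c. *)
Lemma small_quotient (G : topologicalZmodType) :
  hausdorff_space G -> precompact_group G -> infinite_set [set: G] ->
  exists N : zmodClosed G, [/\ closed [set` N],
    infinite_set [set: quotient_group N] & embeds (quotient_group N) (set nat)].
Proof.
move=> Ghaus Gpre /infiniteP/embedsP[x xI].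
(* All the differences x i - x j with i <> j; the pairs with i = j are given the
   default value x 0 - x 1, so that no d k is zero. *)
pose d k := let ij := odflt (0, 1)%N (unpickle k : option (nat * nat)) in
  if ij.1 == ij.2 then x 0%N - x 1%N else x ij.1 - x ij.2.
have d0 k : d k != 0.
  rewrite /d; case: (odflt _ _) => i j /=; case: ifPn => [_|ij].
    by rewrite subr_eq0; apply/eqP => /xI.
  by rewrite subr_eq0; apply: contra ij => /eqP/xI ->.
have /choice[step stepP] : forall kU : nat * set G, exists W : set G,
    nbhs 0 kU.2 -> nbhs 0 W /\
    forall y z, W y -> W z -> kU.2 (y - z) /\ y - z <> d kU.1.
  move=> [k U] /=; have [U0|] := pselect (nbhs 0 U); last by exists setT.
  have [|W W0 WP] := @nbhs_difference G (U `&` ~` [set d k]).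
    apply: filterI => //; apply: open_nbhs_nbhs; split; last first.
      by move=> /= /esym/eqP; exact/negP.
    exact/closed_openC/accessible_closed_set1/hausdorff_accessible.
  by exists W => _; split=> // y z Wy Wz; have [] := WP y z Wy Wz.
pose U := fix U k : set G := if k is k'.+1 then step (k', U k') else setT.
have U0 k : nbhs 0 (U k).
  by elim: k => [|k IH]; [exact: filterT|have [] := stepP (k, U k) IH].
have UB k y z : U k.+1 y -> U k.+1 z -> U k (y - z) /\ y - z <> d k.
  by have [_] := stepP (k, U k) (U0 k); apply.
pose A : set G := \bigcap_k U k.
have A0 : A 0 by move=> k _; exact: nbhs_singleton.
have AB y z : A y -> A z -> A (y - z).
  by move=> Ay Az k _; have [] := UB k y z (Ay k.+1 I) (Az k.+1 I).
pose N : zmodClosed G := subgroup_of A0 AB.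
have NE y : y \in N <-> A y by split=> [/set_mem|Ay]; last exact: mem_set.
exists N; split.
- rewrite subgroup_ofE => y yA k _.
  have := @sub_continuous G (y, y) (U k.+1); rewrite /= subrr.
  move=> /(_ (U0 k.+1))[[B C] /= [By Cy] BC].
  have [z [Az Bz]] := yA _ By.
  have zy := BC (z, y) (conj Bz (nbhs_singleton Cy)).
  have [+ _] := UB k z (z - y) (Az _ I) zy.
  by rewrite subKr.
- apply/infiniteP/embedsP; exists (fun n => quotient_map N (x n)) => i j.
  move=> /quotient_map_eq/NE Aij; apply: contrapT => /eqP ij.
  have dE : d (pickle (i, j)) = x i - x j by rewrite /d pickleK /= (negPf ij).
  have [_] := UB (pickle (i, j)) (x i - x j) 0 (Aij _ I) (A0 _ I).
  by rewrite subr0 dE.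
- have /choice[r rP] := @quotient_map_surj G N.
  have /choice[s sP] : forall k, exists s : seq G,
      forall y, exists i, U k (y - nth 0 s i).
    move=> k; have [F /finite_seqP[s ->] FU] := Gpre _ (U0 k).
    exists s => y; have : [set: G] y by [].
    rewrite -FU => -[f /= fs [u Uu <-]]; exists (index f s).
    by rewrite nth_index // addrC addKr.
  (* The coset [q] is coded by the sequence [c q] of the numbers of translates
     of the [U k] that contain its representative. *)
have /choice[c cP] : forall q, exists c : nat -> nat,
      forall k, U k (r q - nth 0 (s k) (c k)).
    by move=> q; have /choice[c cP] := fun k => sP k (r q); exists c.
  apply: embeds_trans (embeds_nat_fun (embeds_countType nat)).
  exists c => p q pq; rewrite -(rP p) -(rP q); apply/quotient_map_eq/NE => k _.
  have := cP p k.+1; rewrite pq => /UB/(_ (cP q k.+1))[+ _].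
  by rewrite opprB addrA subrK.
Qed.

Lemma density_at_most_card (T : topologicalType) (K : Type) :
  embeds T K -> density_at_most K T.
Proof.
move=> TK; have [|d dP] := @least_cardinal_of_set T (@dense T).
  by exists setT => O [y Oy] _; exists y.
exists d => //; apply: (@card_le_trans _ T _ setT); last exact/embedsP.
apply: dP.2; exists setT; last exact: card_eqxx.
by move=> O [y Oy] _; exists y.
Qed.

Lemma weight_at_most_card (T : topologicalType) (K : Type) :
  embeds T K -> weight_at_most (set K) T.
Proof.
move=> TK; have open_basis : basis (@open T).
  split=> // y A; rewrite nbhsE => -[U [oU Uy] UA]; exists U => //.
have [|w wP] := @least_cardinal_of_set (set T) (@basis T); first by exists open.
exists w => //; apply: (@card_le_trans _ (set_type (@open T)) _ setT).
  by apply: wP.2; exists open => //; exact: card_setT_sym.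
apply/embedsP/(@embeds_trans _ (set T)); last exact: embeds_set.
by exists val; exact: val_inj.
Qed.

(** * The least cardinals *)

Theorem proposition1p4 :
  GCH ->
  is_least_cardinal quotient_density_bound continuum /\
  is_least_cardinal quotient_weight_bound (set continuum).
Proof.
move=> gch; have [G [Ghaus Gpre Ginf Gquot]] := no_small_quotient gch.
split; split.
- move=> H Hhaus Hpre Hinf.
  have [N [Ncl Ninf Nsmall]] := small_quotient Hhaus Hpre Hinf.
  by exists N; split=> //; exact: density_at_most_card.
- move=> L /(_ G Ghaus Gpre Ginf)[N [Ncl Ninf [d [[D Dd DK] _] dL]]].
  apply/embedsP; have [//|LC] := embeds_total (set nat) L.
  have nLN : ~ embeds L nat.
    move=> /embedsP LN; apply: (Gquot N Ncl Ninf).1 Dd _.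
    rewrite /countable (card_le_eql DK); exact: card_le_trans LN.
  have [NL|//] := embeds_total nat L.
  by have [] := GCH_between gch (embeds_refl nat) NL LC.
- move=> H Hhaus Hpre Hinf.
  have [N [Ncl Ninf Nsmall]] := small_quotient Hhaus Hpre Hinf.
  by exists N; split=> //; exact: weight_at_most_card.
- move=> L /(_ G Ghaus Gpre Ginf)[N [Ncl Ninf [w [[B Bb BK] _] wL]]].
  apply/embedsP; have [//|LC] := embeds_total (set (set nat)) L.
  have nLC : ~ embeds L (set nat).
    move=> /embedsP LN; apply: (Gquot N Ncl Ninf).2 Bb _.
    rewrite (card_le_eql BK); exact: card_le_trans LN.
  have [CL|//] := embeds_total (set nat) L.
  by have [] := GCH_between gch (embeds_countType nat) CL LC.
Qed.
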